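(* Let $0<r<1$ and $y=\frac{\sqrt3}{6}$. If $k$ agents of transmission range $r$, starting at the centroid of an equilateral triangle with sides of length $1$, have an evacuation algorithm with worst-case evacuation time $1+2y$ (the optimal evacuation time), then $k\ge \frac1r+1$.
   Context: A single exit lies at a point of the perimeter of the triangle, unknown to the agents. All agents start at the centroid at time $0$ and can move at speed at most $1$. An agent recognizes the exit only when it is at the exit's location. Two agents at distance at most $r$ can exchange information instantly, and agents can act as relays, so information passes instantly between any two agents joined by a chain of agents with consecutive distances at most $r$. An algorithm (deterministic) assigns each agent a predetermined trajectory, which the agent may leave only after it has found the exit or has been notified of the exit's location, and specifies its actions in those cases. The evacuation time for a given exit location is the first time by which all agents have reached the exit; the worst-case evacuation time is the supremum over all exit locations on the perimeter. *)

(* Defs.v *)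
From mathcomp Require Import all_boot all_order all_algebra.
From mathcomp Require Import all_classical all_reals all_analysis.

Set Implicit Arguments.
Unset Strict Implicit.
Unset Printing Implicit Defensive.

Import Order.TTheory GRing.Theory Num.Theory.

Local Open Scope classical_set_scope.
Local Open Scope ring_scope.

Definition plane (R : realType) := 'rV[R]_2.

(* The library norm on ['rV[R]_2] is the sup norm, hence this definition. *)
Definition edist (R : realType) (P Q : plane R) : R :=
  Num.sqrt (\sum_(i < 2) (P 0 i - Q 0 i) ^+ 2).

Definition equilateral (R : realType) (A B C : plane R) (s : R) : Prop :=
  [/\ edist A B = s, edist B C = s & edist C A = s].

Definition centroid (R : realType) (A B C : plane R) : plane R :=
  3^-1 *: (A + B + C).

Definition segment (R : realType) (P Q : plane R) : set (plane R) :=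
  [set (1 - u) *: P + u *: Q | u in [set u : R | 0 <= u <= 1]].

Definition perimeter (R : realType) (A B C : plane R) : set (plane R) :=
  segment A B `|` segment B C `|` segment C A.

(* Time is [[0, +oo)]; values at negative times are irrelevant junk. *)
Definition trajectory_from (R : realType) (O : plane R) (f : R -> plane R) :
    Prop :=
  f 0 = O /\ forall s t : R, 0 <= s -> s <= t -> edist (f s) (f t) <= t - s.

(* [informed r pos e i t]: if the agents move along [pos] and the exit is at
   [e], then by time [t] agent [i] has found the exit or has been notified of
   its location.  Iterating [informed_relay] at a fixed time [t] transmits the
   information instantly along chains of agents with consecutive distances at
   most [r]; relays need not know the exit beforehand. *)
Inductive informed (R : realType) (k : nat) (r : R)
    (pos : 'I_k -> R -> plane R) (e : plane R) : 'I_k -> R -> Prop :=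
| informed_found i t :
    0 <= t -> pos i t = e -> informed r pos e i t
| informed_keep i s t :
    s <= t -> informed r pos e i s -> informed r pos e i t
| informed_relay i j t :
    informed r pos e j t -> edist (pos i t) (pos j t) <= r ->
    informed r pos e i t.

(* A deterministic algorithm for [k] agents.  [plan i] is the predetermined
   trajectory of agent [i]; [run e i] is its actual trajectory when the exit
   is at [e].  The behaviour of an informed agent is an arbitrary function of
   [e]: an informed agent knows [e], and [e] determines the entire run of a
   deterministic algorithm, including when and how each agent is informed. *)
Record algorithm (R : realType) (k : nat) (r : R) (A B C : plane R) :=
  Algorithm {
    plan : 'I_k -> R -> plane R;
    run : plane R -> 'I_k -> R -> plane R;
    plan_trajectory : forall i, trajectory_from (centroid A B C) (plan i);
    run_trajectory : forall e i, perimeter A B C e ->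
      trajectory_from (centroid A B C) (run e i);
    run_uninformed : forall e i t, perimeter A B C e -> 0 <= t ->
      ~ informed r (run e) e i t -> run e i t = plan i t
  }.

Local Open Scope ereal_scope.

(* [+oo] if some agent never reaches the exit. *)
Definition evacuation_time (R : realType) (k : nat) (r : R) (A B C : plane R)
    (alg : algorithm k r A B C) (e : plane R) : \bar R :=
  ereal_inf [set t%:E | t in [set t : R | (0 <= t)%R /\
    forall i : 'I_k, exists s : R, (0 <= s <= t)%R /\ run alg e i s = e]].

Definition worst_case_evacuation_time (R : realType) (k : nat) (r : R)
    (A B C : plane R) (alg : algorithm k r A B C) : \bar R :=
  ereal_sup [set evacuation_time alg e | e in perimeter A B C].

(* Main.v *)
(** Let [T] be the infimum, over exits at the three vertices, of the times at
    which some agent is informed; then [T >= 2 y] because the vertices are at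
    distance [2 y] from the centroid. Before [T] all these runs agree with the
    plan, and at [T] some agent is (almost) at a vertex [V]. If it stayed
    uninformed a little longer for exits at both other vertices, its position
    would be the same in both runs, yet it would have to head at full speed
    for both of them to meet the bound [1 + 2 y]. So it learns immediately of
    an exit at distance [1], through a chain of at most [k - 1] hops of length
    at most [r], whence [1 <= (k - 1) r]. *)

Require Import Defs.
From mathcomp Require Import all_boot all_order all_algebra.
From mathcomp Require Import all_classical all_reals all_analysis.
From mathcomp Require Import ring lra.

Import Order.TTheory GRing.Theory Num.Theory.

Local Open Scope ring_scope.

(* Not the extended distance [edist] of MathComp-Analysis. *)
Local Notation edist := Defs.edist.

(** Cauchy-Schwarz in the plane, by Lagrange's identity. *)
Lemma dot_le (R : realType) (a b c d x z : R) : 0 <= x -> 0 <= z ->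
  a ^+ 2 + b ^+ 2 <= x ^+ 2 -> c ^+ 2 + d ^+ 2 <= z ^+ 2 ->
  a * c + b * d <= x * z.
Proof.
move=> x0 z0 abx cdz; apply: (le_trans (ler_norm _)).
rewrite -ler_sqr ?nnegrE ?mulr_ge0// real_normK ?num_real// exprMn.
apply: le_trans (_ : (a ^+ 2 + b ^+ 2) * (c ^+ 2 + d ^+ 2) <= _); last first.
  by apply: ler_pM => //; rewrite addr_ge0 ?sqr_ge0.
have -> : (a ^+ 2 + b ^+ 2) * (c ^+ 2 + d ^+ 2) =
  (a * c + b * d) ^+ 2 + (a * d - b * c) ^+ 2 by ring.
by rewrite lerDl sqr_ge0.
Qed.

(** * Euclidean geometry of the equilateral triangle *)

Section EuclideanDistance.
Context {R : realType}.
Implicit Types P Q S V : plane R.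

Lemma edist_sqr P Q :
  edist P Q ^+ 2 = (P 0 0 - Q 0 0) ^+ 2 + (P 0 1 - Q 0 1) ^+ 2.
Proof.
rewrite /edist sqr_sqrtr; last by apply: sumr_ge0 => i _; exact: sqr_ge0.
rewrite !big_ord_recl big_ord0 addr0.
by congr ((P 0 _ - Q 0 _) ^+ 2 + (P 0 _ - Q 0 _) ^+ 2); apply/val_inj.
Qed.

Lemma edist_ge0 P Q : 0 <= edist P Q.
Proof. exact: sqrtr_ge0. Qed.

Lemma edist_le P Q (d : R) : 0 <= d ->
  (edist P Q <= d) = ((P 0 0 - Q 0 0) ^+ 2 + (P 0 1 - Q 0 1) ^+ 2 <= d ^+ 2).
Proof. by move=> d0; rewrite -edist_sqr ler_sqr ?nnegrE ?edist_ge0. Qed.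

Lemma edistxx P : edist P P = 0.
Proof.
by apply/eqP; rewrite eq_le edist_ge0 andbT edist_le// !subrr expr0n addr0.
Qed.

Lemma edistC P Q : edist P Q = edist Q P.
Proof.
apply/eqP; rewrite -(eqrXn2 (n := 2)) ?edist_ge0// !edist_sqr.
by apply/eqP; ring.
Qed.

Lemma edist_triangle Q P S : edist P S <= edist P Q + edist Q S.
Proof.
rewrite edist_le ?addr_ge0 ?edist_ge0//.
have /dot_le : 0 <= edist P Q by exact: edist_ge0.
move=> /(_ _ _ _ _ _ (edist_ge0 Q S)).
move=> /(_ (P 0 0 - Q 0 0) (P 0 1 - Q 0 1) (Q 0 0 - S 0 0) (Q 0 1 - S 0 1)).
rewrite !edist_sqr => /(_ (lexx _) (lexx _)).
by have := edist_sqr P Q; have := edist_sqr Q S; nra.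
Qed.

(* A point close to the vertex [V] can gain little on both other vertices:
   the sum of the unit vectors towards them has norm [sqrt 3 < 7 / 4]. *)
Lemma equilateral_approach {V P B C : plane R} {m n : R} :
  equilateral V B C 1 -> 0 <= m <= 1 -> 0 <= n ->
  edist P V <= n -> edist P B <= 1 - m -> edist P C <= 1 - m ->
  2 * m - m ^+ 2 <= n * (7 / 4).
Proof.
move=> [VB BC CV] /andP[m0 m1] n0.
have m1' : 0 <= 1 - m by rewrite subr_ge0.
rewrite !edist_le// => PV PB PC.
have := edist_sqr V B; have := edist_sqr B C; have := edist_sqr C V.
rewrite VB BC CV => CV2 BC2 VB2.
pose w0 := P 0 0 - V 0 0; pose w1 := P 0 1 - V 0 1.
(* The second vector is [(B - V) + (C - V)], of squared length 3. Adding [PB] and [PC] bounds its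
   inner product with [P - V] from below. *)
apply: le_trans (@dot_le _ w0 w1 (B 0 0 + C 0 0 - 2 * V 0 0)
  (B 0 1 + C 0 1 - 2 * V 0 1) _ (7 / 4) n0 _ PV _).
- by have := sqr_ge0 w0; have := sqr_ge0 w1; rewrite /w0 /w1; lra.
- lra.
- by lra.
Qed.

(** Three times the vector from a vertex to the centroid is the sum of the two sides leaving that
    vertex, of squared length 3. *)
Lemma centroid_vertex (A B C V : plane R) : equilateral A B C 1 ->
  [\/ V = A, V = B | V = C] -> 2 * (Num.sqrt 3 / 6) <= edist (centroid A B C) V.
Proof.
move=> [AB BC CA] HV.
have s3 : Num.sqrt 3 ^+ 2 = 3 :> R by rewrite sqr_sqrtr.
have s0 : 0 <= Num.sqrt 3 :> R by exact: sqrtr_ge0.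
have s60 : 0 <= 2 * (Num.sqrt 3 / 6) :> R by rewrite mulr_ge0// divr_ge0.
rewrite -ler_sqr ?nnegrE ?edist_ge0//.
rewrite edist_sqr.
have := edist_sqr A B; have := edist_sqr B C; have := edist_sqr C A.
rewrite AB BC CA /centroid !mxE => CA2 BC2 AB2.
by case: HV => ->; nra.
Qed.

Lemma equilateral_rot {A B C : plane R} {s : R} :
  equilateral A B C s -> equilateral B C A s.
Proof. by case. Qed.

End EuclideanDistance.

(** * Spread of information along relay chains *)

Section Information.
Context {R : realType} {k : nat} {r : R} {pos : 'I_k -> R -> plane R}.
Context {O e : plane R}.
Hypothesis pos_traj : forall i, trajectory_from O (pos i).

Lemma informed_ex_found {i t} : informed r pos e i t ->
  exists j s, [/\ 0 <= s, s <= t & pos j s = e].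
Proof.
elim=> {i t} [i t t0 it|i s t st _ [j [u [u0 us ju]]]|i j t _ + _] //.
- by exists i, t.
- by exists j, u; split => //; exact: le_trans us st.
Qed.

Lemma informed_ge_edist {i t} : informed r pos e i t -> edist O e <= t.
Proof.
move=> /informed_ex_found[j [s [s0 st <-]]]; apply: le_trans st.
have [j0 /(_ 0 s (lexx _) s0)] := pos_traj j.
by rewrite j0 subr0.
Qed.

(* The list [l] is a relay chain: its [n]-th agent is within [n] hops of the
   exit, up to the distance travelled since the exit was first found. A chain
   closing up on itself is not lengthened, so the number of hops stays below
   [k]. *)
Lemma informed_edist {T : R} {i t} : 0 <= r -> 0 <= T ->
  (forall j s, informed r pos e j s -> T <= s) ->
  informed r pos e i t ->
  edist (pos i t) e <= (k%:R - 1) * r + (t - T).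
Proof.
move=> r0 T0 Tle it.
suff [l [ul il lP]] : exists l : seq 'I_k, [/\ uniq l, i \in l &
    forall j, j \in l -> edist (pos j t) e <= (index j l)%:R * r + (t - T)].
  apply: le_trans (lP i il) _; rewrite lerD2r ler_wpM2r// lerBrDr natr1 ler_nat.
  apply: leq_trans (_ : index i l < size l)%N _; first by rewrite index_mem.
  by rewrite -(card_uniqP ul) -[leqRHS]card_ord max_card.
elim: it => {i t} [i t t0 ite|i s t st is_ [l [ul il lP]]|
  i j t jt [l [ul jl lP]] ij].
- exists [:: i]; split => //; first by rewrite inE.
  move=> j; rewrite inE => /eqP ->; rewrite ite edistxx/= eqxx mul0r add0r.
  by rewrite subr_ge0; apply: (Tle i); exact: informed_found.
(* From [s] to [t] an agent moves at most [t - s], exactly the growth of the allowance [t - T]. *)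
- exists l; split => // j jl.
  have s0 : 0 <= s by apply: le_trans (Tle _ _ is_).
  apply: le_trans (edist_triangle (pos j s) _ _) _.
  have [_ /(_ s t s0 st)] := pos_traj j; rewrite edistC.
  by have := lP j jl; lra.
- have [il|il] := boolP (i \in l); first by exists l.
  exists (rcons l i); split; rewrite ?rcons_uniq ?il ?mem_rcons ?inE ?eqxx//.
  move=> j'; rewrite mem_rcons inE => /orP[/eqP ->|j'l]; last first.
    by rewrite -cats1 index_cat j'l; exact: lP.
  rewrite -cats1 index_cat (negbTE il)/= eqxx addn0.
  apply: le_trans (edist_triangle (pos j t) _ _) _.
  have := lP j jl; have : (index j l).+1%:R * r <= (size l)%:R * r.
    by rewrite ler_wpM2r// ler_nat index_mem.
  by rewrite -natr1 mulrDl mul1r; lra.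
Qed.

End Information.

(** * Constraints imposed by the evacuation time *)

Section Evacuation.
Context {R : realType} {k : nat} {r : R} {A B C : plane R}.
Context {alg : algorithm k r A B C}.

(** The slack [d] is there because the infimum defining the evacuation time need not be attained. *)
Lemma evacuation_time_lt (e : plane R) (c d : R) : perimeter A B C e ->
  worst_case_evacuation_time alg = c%:E -> 0 < d ->
  exists2 t, t < c + d & forall i, exists s, 0 <= s <= t /\ run alg e i s = e.
Proof.
move=> pe worst d0.
have : (evacuation_time alg e < (c + d)%:E)%E.
  apply: (@le_lt_trans _ _ c%:E); last by rewrite lte_fin ltrDl.
  by rewrite -worst; apply: ereal_sup_ubound; exists e.
by move=> /ereal_inf_lt[_ [t [t0 ht] <-]]; rewrite lte_fin => tcd; exists t.
Qed.

(* An agent that is about to be at [V] at time [T] and stays uninformed until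
   [T + eta] is then too late for [B] or for [C]. So it must have learnt of one
   of these exits, at distance almost [1], by a chain of relays. *)
Lemma relay_chain_spans_side {V B' C' : plane R} {c T eta s : R} {j : 'I_k} :
  let vertex e := [\/ e = V, e = B' | e = C'] in
  equilateral V B' C' 1 -> (forall e, vertex e -> perimeter A B C e) ->
  0 <= r -> 1 / 2 <= c -> c <= T -> 0 < eta <= 1 / 16 ->
  (forall e, vertex e -> forall d, 0 < d -> exists2 t, t < 1 + c + d &
     forall i, exists u, 0 <= u <= t /\ run alg e i u = e) ->
  (forall e, vertex e -> forall i u, informed r (run alg e) e i u -> T <= u) ->
  T <= s < T + eta / 100 -> run alg V j s = V ->
  1 <= (k%:R - 1) * r + 3 * eta.
Proof.
move=> vertex eqVBC vP r0 c2 cT /andP[eta0 eta1] evac Tle /andP[Ts sT] jsV.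
have vV : vertex V by constructor 1.
(* At [t0] nobody is informed, so the runs for all three vertices still agree with the plan; [t1] is
   when agent [j] is tested for knowledge. *)
pose t0 := T - eta / 100; pose t1 := T + eta.
have [t0_ge0 t0T t01 t0s] : [/\ 0 <= t0, t0 < T, t0 <= t1 & t0 <= s].
  by rewrite /t0 /t1; split; lra.
have run0 e : vertex e -> run alg e j t0 = plan alg j t0.
  move=> ve; apply: run_uninformed => //; first exact: vP.
  by move=> /(Tle _ ve); rewrite leNgt t0T.
have near0 : edist (plan alg j t0) V <= eta / 50.
  rewrite -{1}jsV -(run0 V vV).
  have [_ /(_ _ _ t0_ge0 t0s)] := run_trajectory alg j (vP V vV).
  by move: sT; rewrite /t0; lra.
have step0 e : vertex e ->
    edist (plan alg j t0) (run alg e j t1) <= eta + eta / 100.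
  move=> ve; rewrite -(run0 e ve).
  have [_ /(_ _ _ t0_ge0 t01)] := run_trajectory alg j (vP e ve).
  by rewrite /t0 /t1; lra.
have near1 e : vertex e -> edist (run alg e j t1) V <= eta + 3 * (eta / 100).
  move=> ve; apply: le_trans (edist_triangle (plan alg j t0) _ _) _.
  by rewrite edistC; have := step0 e ve; lra.
(* An uninformed agent has yet to visit [e], and since [c <= T] less than [1 - eta + eta / 100] time
   is left. *)
have late e : vertex e -> ~ informed r (run alg e) e j t1 ->
    edist (plan alg j t1) e <= 1 - (eta - eta / 100).
  move=> ve nje; have t1_ge0 := le_trans t0_ge0 t01.
  rewrite -(run_uninformed (vP e ve) t1_ge0 nje).
  have [|t tlt /(_ j)[u [/andP[u0 ut] jue]]] := evac e ve (eta / 100); first lra.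
  have [ut1|t1u] := leP u t1.
    case: nje; apply: (informed_keep ut1); exact: informed_found.
  have [_ /(_ _ _ t1_ge0 (ltW t1u))] := run_trajectory alg j (vP e ve).
  by rewrite jue /t1; lra.
have found e : vertex e -> edist V e = 1 -> informed r (run alg e) e j t1 ->
    1 <= (k%:R - 1) * r + 3 * eta.
  move=> ve Ve1 /(informed_edist (fun i => run_trajectory alg i (vP e ve)) r0).
  move=> /(_ _ _ (Tle e ve)); rewrite /t1 => H.
  have {H} : edist (run alg e j t1) e <= (k%:R - 1) * r + eta.
    by apply: le_trans (H _) _; [lra | rewrite addrAC subrr add0r].
  have := near1 e ve; rewrite edistC.
  by have := edist_triangle (run alg e j t1) V e; rewrite Ve1; lra.
have vB : vertex B' by constructor 2.
have vC : vertex C' by constructor 3.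
have [VB BC CV] := eqVBC.
have [iB|nB] := pselect (informed r (run alg B') B' j t1).
  exact: (found B' vB VB iB).
have [iC|nC] := pselect (informed r (run alg C') C' j t1).
  by apply: (found C' vC _ iC); rewrite edistC.
have nearP : edist (plan alg j t1) V <= eta + 3 * (eta / 100).
  rewrite -(run_uninformed (vP B' vB) _ nB); first exact: near1.
  exact: le_trans t0_ge0 t01.
(* Uninformed in both runs, the agent is at one planned position near both deadlines. This is
   contradictory: the gain [2 * m - m ^+ 2] exceeds [1.9 * eta], while [n * (7 / 4)] is below
   [1.81 * eta]. *)
have m01 : 0 <= eta - eta / 100 <= 1 by apply/andP; split; lra.
have n0 : 0 <= eta + 3 * (eta / 100) by lra.
have := equilateral_approach eqVBC m01 n0 nearP (late B' vB nB) (late C' vC nC).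
have : eta ^+ 2 <= eta * (1 / 16) by rewrite expr2 ler_wpM2l// ltW.
by lra.
Qed.

End Evacuation.

Theorem theorem5p1 (R : realType) (r y : R) (k : nat) (A B C : plane R)
    (hr : 0 < r < 1) (hy : y = Num.sqrt 3 / 6)
    (hABC : equilateral A B C 1)
    (halg : exists alg : algorithm k r A B C,
        worst_case_evacuation_time alg = (1 + 2 * y)%:E) :
  r^-1 + 1 <= k%:R.
Proof.
have [r0 r1] := andP hr; have [alg worst] := halg.
pose vertex e := [\/ e = A, e = B | e = C].
have c2 : 1 / 2 <= 2 * y.
  have : 3 / 2 <= Num.sqrt 3 :> R.
    by rewrite -ler_sqr ?nnegrE ?sqrtr_ge0// ?sqr_sqrtr//; lra.
  by rewrite hy; lra.
have segl P Q : segment P Q (P : plane R).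
  by exists 0 => /=; rewrite ?lexx ?ler01// subr0 scale1r scale0r addr0.
have vP e : vertex e -> perimeter A B C e.
  by case=> ->; [left; left|left; right|right]; exact: segl.
have evac e : vertex e -> forall d, 0 < d -> exists2 t, t < 1 + 2 * y + d &
    forall i, exists u, 0 <= u <= t /\ run alg e i u = e.
  by move=> ve d; apply: evacuation_time_lt => //; exact: vP.
have vA : vertex A by constructor 1.
(* Without agents, evacuation is vacuously complete at time 0. *)
have k0 : (0 < k)%N.
  rewrite lt0n; apply/eqP => k0; subst k.
  suff : (worst_case_evacuation_time alg <= 0)%E by rewrite worst lee_fin; lra.
  apply: ge_ereal_sup => _ [e _ <-]; apply: ereal_inf_lbound.
  by exists 0 => //; split => // -[].
pose D := [set s | exists e i, vertex e /\ informed r (run alg e) e i s]%classic.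
have D0 : (D !=set0)%classic.
  have [t _ /(_ (Ordinal k0))[u [/andP[u0 _] uA]]] := evac A vA 1 ltr01.
  by exists u, A, (Ordinal k0); split => //; exact: informed_found.
have Dlb : lbound D (2 * y).
  move=> s [e [i [ve]]].
  move=> /(informed_ge_edist (fun i => run_trajectory alg i (vP e ve))).
  by apply: le_trans; rewrite hy; exact: centroid_vertex.
have Dinf : has_inf D by split => //; exists (2 * y).
have Tle e : vertex e ->
    forall i u, informed r (run alg e) e i u -> inf D <= u.
  by move=> ve i u iu; apply: ge_inf; [case: Dinf | exists e, i].
have cT : 2 * y <= inf D by exact: lb_le_inf.
have main eta : 0 < eta <= 1 / 16 -> 1 <= (k%:R - 1) * r + 3 * eta.
  move=> eta01; have [eta0 eta1] := andP eta01.
  (* [inf D] may not be attained, so a time slightly above it is taken and traced back to an agent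
     standing at a vertex. *)
  have [|u [e [i [ve iu]]] ult] := @inf_adherent R D (eta / 100) _ Dinf.
    lra.
  have [j [s [s0 su jse]]] := informed_ex_found iu.
  have sT : inf D <= s < inf D + eta / 100.
    rewrite (le_lt_trans su ult) andbT.
    by apply: (Tle e ve j); exact: informed_found.
  have r0' := ltW r0.
  case: (ve) => eE; rewrite eE in jse.
  - exact: (relay_chain_spans_side hABC vP r0' c2 cT eta01 evac Tle sT jse).
  - have perm x : [\/ x = B, x = C | x = A] -> vertex x.
      by case=> ->; [constructor 2|constructor 3|constructor 1].
    apply: (relay_chain_spans_side (equilateral_rot hABC) _ r0' c2 cT eta01
      _ _ sT jse) => x /perm vx; [exact: vP|exact: evac|exact: Tle].
  - have perm x : [\/ x = C, x = A | x = B] -> vertex x.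
      by case=> ->; [constructor 3|constructor 1|constructor 2].
    apply: (relay_chain_spans_side (equilateral_rot (equilateral_rot hABC)) _
      r0' c2 cT eta01 _ _ sT jse) => x /perm vx;
      [exact: vP|exact: evac|exact: Tle].
have spans : 1 <= (k%:R - 1) * r.
  (* Let [eta] tend to 0: [eta = d / 3] if allowed, else [1 / 16], for which [3 * eta < d]. *)
  apply/ler_addgt0Pr => d d0; have [dle|dgt] := leP (d / 3) (1 / 16).
    by have := main (d / 3); rewrite dle andbT; lra.
  by have := main (1 / 16); rewrite lexx; lra.
by rewrite -lerBrDr -div1r ler_pdivrMr.
Qed.
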